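(* For each integer $k\ge 1$ let $M_k$ be a random variable with values in $\{1,2,3,\ldots\}$ and distribution $p_m(k)=\boldsymbol{P}\{M_k=m\}$, $m\ge1$, and let $s_k=\sup_{m\ge 1}p_m(k)$. Assume that $s_k\to 0$ as $k\to\infty$ in such a way that $$\lim_{k\to\infty}s_k\ln k=0 .$$ For each $k$ let $N_k$ be an integer-valued random variable, defined on the same probability space as $M_k$, which conditionally on $M_k=m$ is equiprobable on $\{0,1,\ldots,m\}$, i.e. the joint distribution is $$\boldsymbol{P}\{N_k=n,\,M_k=m\}=\frac{p_m(k)}{m+1},\qquad m=1,2,\ldots,\quad n=0,1,\ldots,m .$$ Let $Q_k=N_k/M_k$, a random variable with values in $\mathbb{Q}\cap[0,1]$, and let $F_{Q_k}(x)=\boldsymbol{P}\{Q_k\le x\}$, $x\in\mathbb{R}$, be its cumulative distribution function. Then: (i) for every rational number $q\in\mathbb{Q}\cap[0,1]$, $$\lim_{k\to\infty}\boldsymbol{P}\{Q_k=q\}=0;$$ (ii) for all real numbers $a,b$ with $0\le a<b\le 1$, $$\lim_{k\to\infty}\boldsymbol{P}\{a<Q_k\le b\}=b-a;$$ (iii) for every $x\in\mathbb{R}$, $$\lim_{k\to\infty}F_{Q_k}(x)=\begin{cases}0 & x<0,\\ x & 0\le x<1,\\ 1 & 1\le x.\end{cases}$$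
   Context: $\ln$ denotes the natural logarithm. The fraction $N_k/M_k$ is not required to be in lowest terms: the event $\{Q_k=q\}$ is the event that the rational number $N_k/M_k$ equals $q$, so that if $q=n/m$ with $n,m$ coprime, then $\boldsymbol{P}\{Q_k=q\}=\sum_{\ell\ge1}\boldsymbol{P}\{N_k=\ell n,\,M_k=\ell m\}$. The subscript $k$ on $N$ and $Q$ makes explicit the dependence on the denominator $M_k$. *)

(* Defs.v *)
From HB Require Import structures.
From mathcomp Require Import all_boot all_order all_algebra.
From mathcomp Require Import all_classical all_reals all_analysis.

Set Implicit Arguments.
Unset Strict Implicit.
Unset Printing Implicit Defensive.

Import Order.TTheory GRing.Theory Num.Theory.
Import numFieldNormedType.Exports.

Local Open Scope classical_set_scope.
Local Open Scope ring_scope.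

HB.instance Definition _ := isPointed.Build int 0.

(* int and rat carry the discrete sigma-algebra, like nat in the library. *)
HB.instance Definition _ := @isMeasurable.Build default_measure_display
  int (@discrete_measurable int) (@discrete_measurable0 int)
  (@discrete_measurableC int) (@discrete_measurableU int).

HB.instance Definition _ := @isMeasurable.Build default_measure_display
  rat (@discrete_measurable rat) (@discrete_measurable0 rat)
  (@discrete_measurableC rat) (@discrete_measurableU rat).

Section mass.
Context d (T : measurableType d) (R : realType) (P : probability T R).

(* The library's pmf is restricted to real-valued random variables. *)
Definition mass (M : {RV P >-> nat}) (m : nat) : R :=
  fine (P [set w | M w = m]).

Definition sup_mass (M : {RV P >-> nat}) : R :=
  sup [set mass M m | m in [set m | (0 < m)%N]].

End mass.

Section rv_ratio.
Context d (T : measurableType d).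

(* An element of rat, so N w / M w is not required to be in lowest terms. *)
Definition rv_ratio (N : {mfun T >-> int}) (M : {mfun T >-> nat}) (w : T) : rat :=
  (N w)%:~R / (M w)%:R.

Variables (N : {mfun T >-> int}) (M : {mfun T >-> nat}).

Let measurable_rv_ratio : measurable_fun [set: T] (rv_ratio N M).
Proof.
move=> _ A _; rewrite setTI.
pose B (m : nat) := [set n : int | A (n%:~R / m%:R)].
rewrite (_ : _ @^-1` _ = \bigcup_m (M @^-1` [set m] `&` N @^-1` B m)).
  apply: bigcupT_measurable => m; apply: measurableI.
    by rewrite -[X in measurable X]setTI; exact: measurable_funPT.
  by rewrite -[X in measurable X]setTI; exact: measurable_funPT.
apply/seteqP; split=> [w Aw|w [m _ [/= <-]]//].
by exists (M w).
Qed.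

HB.instance Definition _ :=
  isMeasurableFun.Build _ _ _ _ (rv_ratio N M) measurable_rv_ratio.

Definition real_rv_ratio (R : realType) (w : T) : R := ratr (rv_ratio N M w).

Let measurable_real_rv_ratio (R : realType) :
  measurable_fun [set: T] (@real_rv_ratio R).
Proof.
move=> _ A _; rewrite setTI.
rewrite (_ : _ @^-1` A = [set: T] `&` rv_ratio N M @^-1` (ratr @^-1` A)).
  exact: measurable_rv_ratio.
by rewrite setTI.
Qed.

HB.instance Definition _ (R : realType) :=
  isMeasurableFun.Build _ _ _ _ (@real_rv_ratio R) (@measurable_real_rv_ratio R).

End rv_ratio.

Arguments real_rv_ratio {d T} N M {R} w.

(* Main.v *)
(* Given M = m, the number of n <= m with n / m in an interval of length c
   (or in a singleton, with c = 0) differs from c * m by at most 1, so the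
   conditional probability of {Q in I} exceeds c by at most 2 / (m + 1), and
   likewise for the complement.  Splitting at M < K, an event of probability
   at most K * sup_mass M, gives
   |P(Q in I) - c| <= 2 / (K + 1) + K * sup_mass M for every K; this is small
   for K large and then k large, because sup_mass (M k) tends to 0. *)
Require Import Defs.
From HB Require Import structures.
From mathcomp Require Import all_boot all_order all_algebra.
From mathcomp Require Import all_classical all_reals all_analysis.
From mathcomp Require Import lra.

Set Implicit Arguments.
Unset Strict Implicit.
Unset Printing Implicit Defensive.

Import Order.TTheory GRing.Theory Num.Theory.
Import numFieldNormedType.Exports.

Local Open Scope classical_set_scope.
Local Open Scope ring_scope.

(** * Reduction of an event to the fibres of a discrete variable *)

Lemma measurable_preimage_discrete d d' (T : measurableType d)
    (T' : measurableType d') (f : {mfun T >-> T'}) (B : set T') :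
  measurable B -> measurable (f @^-1` B).
Proof.
by move=> mB; rewrite -[X in measurable X]setTI; exact: measurable_funPT.
Qed.

(** Law of total probability: the fibres of [M] form a countable partition of total mass 1. The
    bound is in product form, so null fibres need no separate case. *)
Lemma probability_le_fiberwise d (T : measurableType d) (R : realType)
    (P : probability T R) (M : {RV P >-> nat}) (A : set T) (u : R) :
    measurable A -> 0 <= u ->
    (forall m, (P (A `&` M @^-1` [set m]) <= u%:E * P (M @^-1` [set m]))%E) ->
  (P A <= u%:E)%E.
Proof.
move=> mA u0 Au.
have mM m : measurable (M @^-1` [set m]) by exact: measurable_preimage_discrete.
have tM : trivIset [set: nat] (fun m => M @^-1` [set m]).
  by apply: trivIset_preimage1.
have cM : \bigcup_m (M @^-1` [set m]) = [set: T].
  by apply/seteqP; split=> // w _; exists (M w).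
have PM : (\sum_(0 <= m <oo) P (M @^-1` [set m]) = 1)%E.
  rewrite -measure_semi_bigcup ?cM//; exact: probability_setT.
rewrite -[A]setIT -cM setI_bigcupr measure_semi_bigcup//; last 3 first.
- by move=> m; exact: measurableI.
- exact: trivIset_setIl.
- by apply: bigcupT_measurable => m; exact: measurableI.
rewrite -[leRHS]mule1 -PM -nneseriesZl//.
by apply: lee_nneseries => // m _; exact: Au.
Qed.

(** * Quantitative bounds for a single pair [M], [N] *)

Section conditionally_uniform.
Context d (T : measurableType d) (R : realType) (P : probability T R).
Context (M : {RV P >-> nat}) (N : {RV P >-> int}).
Hypothesis M_gt0 : forall w, (1 <= M w)%N.
Hypothesis joint_law : forall m n : nat, (1 <= m)%N -> (n <= m)%N ->
  P [set w | N w = n%:Z /\ M w = m] = (mass M m / (m%:R + 1))%:E.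

Let mM m : measurable (M @^-1` [set m]).
Proof. exact: measurable_preimage_discrete. Qed.

Let mG (n : int) m : measurable [set w | N w = n /\ M w = m].
Proof.
rewrite (_ : [set w | _] = N @^-1` [set n] `&` M @^-1` [set m])//.
by apply: measurableI; exact: measurable_preimage_discrete.
Qed.

Lemma massE m : (mass M m)%:E = P (M @^-1` [set m]).
Proof. by rewrite /mass fineK// fin_num_measure//; exact: mM. Qed.

Lemma mass_ge0 m : 0 <= mass M m.
Proof. by rewrite /mass fine_ge0. Qed.

Lemma mass_le_sup m : (1 <= m)%N -> mass M m <= sup_mass M.
Proof.
move=> m1; apply: ub_le_sup; last by exists m.
(* The real [sup] dominates a set known to be bounded above; here 1 bounds all masses. *)
exists 1 => _ [i _ <-]; rewrite -lee_fin massE probability_le1//.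
Qed.

(** [joint_law] describes only the numerators from 0 to m. Their m + 1 disjoint atoms, each of
    probability [mass M m / (m + 1)], already exhaust the probability of M = m, so other values of
    [N] form a null event. *)
Lemma numerator_range_null m : (1 <= m)%N ->
  P (M @^-1` [set m] `\`
    \big[setU/set0]_(n < m.+1) [set w | N w = n%:Z /\ M w = m]) = 0%E.
Proof.
move=> m1; set U := \big[setU/set0]_(n < _) _.
have mU : measurable U by apply: bigsetU_measurable.
have PU : P U = P (M @^-1` [set m]).
  rewrite measure_bigsetU_ord_cond//; last first.
    move=> i j _ _ [w [/= [Ni _] [Nj _]]].
    by apply/val_inj; case: (etrans (esym Ni) Nj).
  rewrite (eq_bigr (fun=> (mass M m / (m%:R + 1))%:E)); last first.
    by move=> i _; apply: joint_law; rewrite // -ltnS.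
  rewrite sumEFin sumr_const card_ord -massE.
  by congr EFin; rewrite -[LHS]mulr_natr -natr1 divfK.
rewrite measureD//; last by rewrite ltey_eq fin_num_measure.
rewrite setIidr; last first.
  rewrite /U -(bigcup_mkord _ (fun n => [set w | N w = Posz n /\ M w = m])).
  by move=> w [i _ [_]].
apply: (etrans (congr1 (fun x => P (M @^-1` [set m]) - x)%E PU)).
by rewrite subee// fin_num_measure.
Qed.

(** Up to a null set, the event is the union of the atoms selected by [B], all of equal probability.
    An upper bound is enough, since lower bounds will come from complements. *)
Lemma conditional_probability_le (B : pred int) m : (1 <= m)%N ->
  (P [set w | B (N w) /\ M w = m] <=
   ((count (fun n : nat => B n) (iota 0 m.+1))%:R * (mass M m / (m%:R + 1)))%:E)%E.
Proof.
move=> m1.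
pose G n := [set w | N w = Posz n /\ M w = m].
pose F n := if B (Posz n) then G n else set0.
pose U := \big[setU/set0]_(n < m.+1) F n.
pose D := M @^-1` [set m] `\` \big[setU/set0]_(n < m.+1) G n.
have mF n : measurable (F n) by rewrite /F; case: ifP => // _; exact: mG.
have mU : measurable U by apply: bigsetU_measurable.
have mD : measurable D.
  apply: measurableD; first exact: mM.
  by apply: bigsetU_measurable => i _; exact: mG.
have PF : (P U <= ((count (fun n : nat => B n) (iota 0 m.+1))%:R *
    (mass M m / (m%:R + 1)))%:E)%E.
  apply: le_trans (Boole_inequality _ _) _ => //.
  rewrite (eq_bigr (fun n : 'I_m.+1 =>
    ((B (Posz n))%:R * (mass M m / (m%:R + 1)))%:E)); last first.
    move=> i _; rewrite /F; case: ifP => _; rewrite ?mul0r ?measure0// mul1r.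
    by apply: joint_law; rewrite // -ltnS.
  rewrite sumEFin lee_fin -mulr_suml -natr_sum -sum1_count.
  rewrite -(big_mkord xpredT (fun n => nat_of_bool (B (Posz n)))).
  by rewrite [in leRHS]big_mkcond /index_iota subn0.
apply: le_trans PF.
(* Adjoining the null set [D] costs nothing and makes the union cover the event. *)
have -> : P U = P (U `|` D).
  by rewrite measureU0//; exact: numerator_range_null.
apply: le_measure; rewrite ?inE//.
- rewrite (_ : [set w | _] = N @^-1` [set` B] `&` M @^-1` [set m])//.
  by apply: measurableI; exact: measurable_preimage_discrete.
- exact: measurableU.
move=> w /= [Bw Mw].
have [Gw|Gw] := pselect ((\big[setU/set0]_(n < m.+1) G n) w); last by right.
left; move: Gw; rewrite /U -!bigcup_mkord => -[n nm Gn]; exists n => //.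
by case: (Gn) => Nw _; rewrite /F -Nw Bw.
Qed.

(** The slack 2 lets the lemma apply to an event and to its complement alike: an error of 1 in a
    count becomes 2 for the complement, because there are m + 1 numerators and not m. *)
Lemma ratio_probability_le (B : pred rat) (c : R) (K : nat) :
    0 <= c ->
    (forall m, (1 <= m)%N ->
      (count (fun n : nat => B (n%:R / m%:R)) (iota 0 m.+1))%:R <= c * m%:R + 2) ->
  (P [set w | B (rv_ratio N M w)] <= (c + 2 / K.+1%:R + K%:R * sup_mass M)%:E)%E.
Proof.
move=> c0 Bc; set A := [set w | _].
have mA : measurable A.
  by apply: (@measurable_preimage_discrete _ _ _ _ (rv_ratio N M) [set` B]).
have mlt : measurable [set w | (M w < K)%N].
  by apply: (@measurable_preimage_discrete _ _ _ _ M [set m | (m < K)%N]).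
(* The part with M >= K gives c + 2 / (K + 1), the part with M < K gives K * [sup_mass M]. *)
rewrite (measureDI P mA mlt) EFinD; apply: leeD.
- apply: (@probability_le_fiberwise _ _ _ _ M).
  + exact: measurableD.
  + by rewrite addr_ge0// divr_ge0.
  move=> m; have [mK|Km] := ltnP m K.
    rewrite (_ : _ `&` _ = set0) ?measure0 ?mule_ge0 ?lee_fin ?addr_ge0 ?divr_ge0//.
    by apply/seteqP; split=> // w [[_ /=]] + Mw; rewrite Mw mK.
  have [->|m0] := posnP m.
    rewrite (_ : _ `&` _ = set0) ?measure0 ?mule_ge0 ?lee_fin ?addr_ge0 ?divr_ge0//.
    by apply/seteqP; split=> // w [_ /=] Mw; have := M_gt0 w; rewrite Mw.
  have := @conditional_probability_le (fun n => B (n%:~R / m%:R)) m m0.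
  have mle : measurable [set w | B ((N w)%:~R / m%:R) /\ M w = m].
    rewrite (_ : [set w | _] =
      N @^-1` [set n | B (n%:~R / m%:R)] `&` M @^-1` [set m])//.
    by apply: measurableI; exact: measurable_preimage_discrete.
  move=> le_count; apply: le_trans (le_trans _ le_count) _.
    apply: le_measure; rewrite ?inE//.
      by apply: measurableI; [exact: measurableD|exact: mM].
    by move=> w [[+ _] /= Mw]; rewrite /A /= /rv_ratio Mw.
  rewrite -massE -EFinM lee_fin mulrCA mulrC ler_wpM2r ?mass_ge0//.
  have m1 : 0 < m%:R + 1 :> R by rewrite natr1.
  (* Since K <= m, (c m + 2) / (m + 1) <= c + 2 / (K + 1). *)
  rewrite ler_pdivrMr// (le_trans (Bc _ m0))// mulrDl; apply: lerD.
    by rewrite ler_wpM2l// lerDl.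
  by rewrite mulrAC ler_pdivlMr// ler_wpM2l// natr1 ler_nat ltnS.
- apply: (@le_trans _ _ (P (\big[setU/set0]_(m < K) M @^-1` [set nat_of_ord m]))).
    apply: le_measure; rewrite ?inE; first exact: measurableI.
      by apply: bigsetU_measurable => i _; exact: mM.
    rewrite -(bigcup_mkord K (fun m => M @^-1` [set m])) => w [_ /= MK].
    by exists (M w).
  have mMK i : (i < K)%N -> measurable (M @^-1` [set i]) by move=> _; exact: mM.
  apply: le_trans (Boole_inequality P mMK) _.
  rewrite (eq_bigr (fun i : 'I_K => (mass M i)%:E)); last by move=> i _; rewrite massE.
  rewrite sumEFin lee_fin mulr_natl -[X in _ *+ X]card_ord -sumr_const.
  (* The supremum ranges over positive values only; the value 0 has mass 0. *)
  apply: ler_sum => i _; have [i0|i0] := posnP i; last exact: mass_le_sup.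
  apply: le_trans (mass_le_sup (leqnn 1)); rewrite i0.
  suff -> : mass M 0 = 0 by exact: mass_ge0.
  rewrite /mass (_ : [set w | _] = set0) ?measure0//.
  by apply/seteqP; split=> // w /= Mw; have := M_gt0 w; rewrite Mw.
Qed.

Lemma ratio_probability_near (B : pred rat) (c : R) (K : nat) :
    0 <= c <= 1 ->
    (forall m, (1 <= m)%N ->
      c * m%:R - 1 <= (count (fun n : nat => B (n%:R / m%:R)) (iota 0 m.+1))%:R
        <= c * m%:R + 1) ->
  (`|fine (P [set w | B (rv_ratio N M w)]) - c| <=
     2 / K.+1%:R + K%:R * sup_mass M).
Proof.
move=> /andP[c0 c1] Bc; set A := [set w | _].
have mA : measurable A.
  by apply: (@measurable_preimage_discrete _ _ _ _ (rv_ratio N M) [set` B]).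
have PA : (fine (P A))%:E = P A by rewrite fineK// fin_num_measure.
have le1 : (P A <= (c + 2 / K.+1%:R + K%:R * sup_mass M)%:E)%E.
  apply: ratio_probability_le => // m m0.
  by have /andP[_ /le_trans->//] := Bc m m0; rewrite lerD2l ler1n.
have le2 : (P (~` A) <= (1 - c + 2 / K.+1%:R + K%:R * sup_mass M)%:E)%E.
  rewrite (_ : ~` A = [set w | predC B (rv_ratio N M w)]); last first.
    by apply/seteqP; split=> w /= /negP.
  apply: ratio_probability_le => [|m m0]; first by rewrite subr_ge0.
  have /andP[lo _] := Bc m m0.
  (* The complement selects m + 1 minus the count for [B], hence at most (1 - c) m + 2
     numerators. *)
  have := count_predC (fun n : nat => B (n%:R / m%:R)) (iota 0 m.+1).
  rewrite (@eq_count _ (predC _) (fun n : nat => predC B (n%:R / m%:R)))//.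
  rewrite size_iota.
  move=> /(congr1 (fun n => n%:R : R)); rewrite natrD -natr1.
  by move: lo; move: (count _ _)%:R (count _ _)%:R (m%:R) => x y z; lra.
move: le1 le2; rewrite probability_setC// -PA /= -EFinB !lee_fin ler_norml.
move: (fine (P A)) (2 / K.+1%:R) (K%:R * sup_mass M) => p x y.
by move=> *; apply/andP; split; lra.
Qed.

End conditionally_uniform.

(** * Counting fractions with a fixed denominator *)

Lemma count_eq_ratio_le1 (q : rat) (m : nat) (s : seq nat) :
  uniq s -> (1 <= m)%N -> (count (fun n : nat => n%:R / m%:R == q) s <= 1)%N.
Proof.
move=> us m0; have mn0 : m%:R != 0 :> rat by rewrite pnatr_eq0 -lt0n.
have [/hasP[n0 _ /eqP n0q]|] := boolP (has (fun n : nat => n%:R / m%:R == q) s).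
  (* For m >= 1 the map n -> n / m is injective, so only the witness [n0] can be counted. *)
  apply: (@leq_trans (count (pred1 n0) s)); last by rewrite count_uniq_mem// leq_b1.
  apply: sub_count => n /eqP; rewrite -n0q => /(divIf mn0)/eqP.
  by rewrite eqr_nat.
by rewrite has_count -leqNgt => /leq_trans->.
Qed.

Lemma count_natr_le (R : realType) (x : R) (m : nat) : 0 <= x <= m%:R ->
  count (fun n : nat => n%:R <= x) (iota 0 m.+1) = (Num.truncn x).+1.
Proof.
move=> /andP[x0 xm].
rewrite (@eq_count _ _ (fun n => (n <= Num.truncn x)%N)); last first.
  by move=> n; rewrite truncn_ge_nat.
have tm : (Num.truncn x <= m)%N by rewrite -(natrK (R := R) m) le_truncn.
(* Cut the range just after the integer part of x: all numerators before the cut count, none after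
   it. *)
rewrite -(subnKC tm) -addSn iotaD count_cat.
rewrite (@eq_in_count _ _ predT); last by move=> n; rewrite mem_iota ltnS.
rewrite count_predT size_iota (@eq_in_count _ _ pred0); last first.
  by move=> n; rewrite mem_iota add0n => /andP[tn _]; rewrite leqNgt tn.
by rewrite count_pred0 addn0.
Qed.

(** The condition is n <= x m, so the count is the integer part of x m plus 1, which lies between x
    m and x m + 1. *)
Lemma count_ratio_le (R : realType) (x : R) (m : nat) : 0 <= x <= 1 -> (1 <= m)%N ->
  x * m%:R - 1 <=
    (count (fun n : nat => ratr (n%:R / m%:R : rat) <= x) (iota 0 m.+1))%:R
    <= x * m%:R + 1.
Proof.
move=> /andP[x0 x1] m0; have m_gt0 : 0 < m%:R :> R by rewrite ltr0n.
rewrite (@eq_count _ _ (fun n : nat => n%:R <= x * m%:R)); last first.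
  by move=> n; rewrite fmorph_div/= !ratr_nat ler_pdivrMr.
have xm0 : 0 <= x * m%:R by rewrite mulr_ge0.
rewrite count_natr_le; last by rewrite xm0 ler_piMl.
have /andP[lo hi] := truncn_itv xm0.
move: lo hi; rewrite -natr1; move: (x * _) (Num.truncn _)%:R => y t lo hi.
by apply/andP; split; lra.
Qed.

(** * Passage to the limit *)

Lemma ratio_probability_cvg (R : realType)
    (d : nat -> measure_display) (T : forall k : nat, measurableType (d k))
    (P : forall k : nat, probability (T k) R)
    (M : forall k : nat, {RV (P k) >-> nat})
    (N : forall k : nat, {RV (P k) >-> int})
    (B : pred rat) (c : R) :
    (forall k, (1 <= k)%N -> forall w, (1 <= M k w)%N) ->
    sup_mass (M k) @[k --> \oo] --> (0 : R) ->
    (forall k, (1 <= k)%N -> forall m n : nat, (1 <= m)%N -> (n <= m)%N ->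
       P k [set w | N k w = n%:Z /\ M k w = m]
         = (mass (M k) m / (m%:R + 1))%:E) ->
    0 <= c <= 1 ->
    (forall m, (1 <= m)%N ->
      c * m%:R - 1 <= (count (fun n : nat => B (n%:R / m%:R)) (iota 0 m.+1))%:R
        <= c * m%:R + 1) ->
  P k [set w | B (rv_ratio (N k) (M k) w)] @[k --> \oo] --> c%:E.
Proof.
move=> M_gt0 s0 joint_law c01 Bc.
apply/fine_cvgP; split.
  apply: nearW => k; rewrite fin_num_measure//.
  by apply: (@measurable_preimage_discrete _ _ _ _ (rv_ratio (N k) (M k)) [set` B]).
apply/cvgrPdist_le => e e0.
(* Then 4 / e < K + 1, so 2 / (K + 1) <= e / 2. With K fixed, k is taken so large that
   [sup_mass (M k)] <= e / (2 (K + 1)), which bounds the other term by e / 2. *)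
pose K := Num.truncn (4 / e).
have K0 : 0 < K.+1%:R :> R by [].
have Ke : 2 / K.+1%:R <= e / 2.
  have := truncnS_gt (4 / e); rewrite -/K ltr_pdivrMr// => Ke.
  rewrite ler_pdivrMr// mulrAC ler_pdivlMr//.
  by move: Ke; move: (K.+1%:R) => z; lra.
have e' : 0 < e / 2 / K.+1%:R by rewrite !divr_gt0.
move/cvgrPdist_le : s0 => /(_ _ e') s0.
near=> k.
have k1 : (1 <= k)%N by near: k; exists 1%N.
have sk : `|0 - sup_mass (M k)| <= e / 2 / K.+1%:R by near: k.
rewrite distrC.
apply: le_trans (ratio_probability_near (M_gt0 _ k1) (joint_law _ k1) K c01 Bc) _.
rewrite [leRHS]splitr lerD//.
move: sk; rewrite sub0r normrN ler_pdivlMr// => sk.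
apply: le_trans sk; rewrite mulrC.
apply: (@le_trans _ _ (`|sup_mass (M k)| * K%:R)).
  by rewrite ler_wpM2r// ler_norm.
by rewrite ler_wpM2l// ler_nat.
Unshelve. all: by end_near. Qed.

Theorem proposition5p2 (R : realType)
  (d : nat -> measure_display) (T : forall k : nat, measurableType (d k))
  (P : forall k : nat, probability (T k) R)
  (M : forall k : nat, {RV (P k) >-> nat})
  (N : forall k : nat, {RV (P k) >-> int})
  (M_gt0 : forall k : nat, (1 <= k)%N -> forall w : T k, (1 <= M k w)%N)
  (sup_mass_cvg0 : sup_mass (M k) @[k --> \oo] --> (0 : R))
  (sup_mass_ln_cvg0 : sup_mass (M k) * ln (k%:R : R) @[k --> \oo] --> (0 : R))
  (joint_law : forall k : nat, (1 <= k)%N ->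
     forall m n : nat, (1 <= m)%N -> (n <= m)%N ->
       P k [set w | N k w = n%:Z /\ M k w = m]
         = (mass (M k) m / (m%:R + 1))%:E) :
  [/\ forall q : rat, 0 <= q <= 1 ->
        P k [set w | rv_ratio (N k) (M k) w = q] @[k --> \oo] --> (0%:E : \bar R),
      forall a b : R, 0 <= a -> a < b -> b <= 1 ->
        P k [set w | a < ratr (rv_ratio (N k) (M k) w) <= b] @[k --> \oo]
          --> (b - a)%:E
    & forall x : R,
        cdf (real_rv_ratio (N k) (M k) : {RV (P k) >-> R}) x @[k --> \oo]
          --> (if x < 0 then 0 else if x < 1 then x else 1)%:E].
Proof.
(* Every claim now reduces to a count of numerators that stays within 1 of c m. *)
have cvg_ratio := @ratio_probability_cvg R d T P M N _ _ M_gt0 sup_mass_cvg0 joint_law.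
pose F (x : R) k := P k [set w | ratr (rv_ratio (N k) (M k) w) <= x].
have cvg_le01 x : 0 <= x <= 1 -> F x k @[k --> \oo] --> x%:E.
  move=> x01.
  apply: (cvg_ratio (fun r => ratr r <= x)) => // m m1; exact: count_ratio_le.
have mle k x : measurable [set w | ratr (rv_ratio (N k) (M k) w) <= x :> R].
  by apply: (@measurable_preimage_discrete _ _ _ _ (rv_ratio (N k) (M k))
    [set r | ratr r <= x]).
split.
- move=> q q01.
  rewrite (_ : (fun k => _) =
    (fun k => P k [set w | pred1 q (rv_ratio (N k) (M k) w)])); last first.
    by apply/funext => k; congr (P k _); apply/seteqP; split=> w /= /eqP.
  (* Here c = 0, and at most one numerator gives the value q. *)
  apply: cvg_ratio => [|m m1]; first by rewrite lexx ler01.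
  rewrite mul0r !add0r (le_trans (lerN10 _))//.
  by rewrite (ler_nat R _ 1) count_eq_ratio_le1// iota_uniq.
- move=> a b a0 ab b1.
  rewrite (_ : (fun k => _) =
    (fun k => F b k - F a k)%E); last first.
    apply/funext => k; rewrite /F.
    rewrite (_ : [set w | _] = [set w | ratr (rv_ratio (N k) (M k) w) <= b] `\`
      [set w | ratr (rv_ratio (N k) (M k) w) <= a]); last first.
      apply/seteqP; split=> w /=.
        by move=> /andP[aQ ->]; split=> //; apply/negP; rewrite -ltNge.
      by move=> [-> /negP]; rewrite -ltNge andbT.
    rewrite measureD//; last by rewrite ltey_eq fin_num_measure.
    by rewrite setIidr// => w /= /le_trans->//; exact: ltW.
  rewrite EFinB; apply: cvgeB => //; apply: cvg_le01.
    by rewrite b1 (le_trans a0)// ltW.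
  by rewrite a0 (le_trans _ b1)// ltW.
- move=> x.
  rewrite (_ : (fun k => _) = F x)//.
  have [x0|x0] := ltP x 0.
    (* For x < 0 no numerator counts, so c = 0. *)
    apply: (cvg_ratio (fun r => ratr r <= x)) => [|m m1].
      by rewrite lexx ler01.
    rewrite (@eq_count _ _ pred0) => [|n].
      by rewrite count_pred0 mul0r !add0r lerN10 ler01.
    by apply/negbTE; rewrite -ltNge (lt_le_trans x0)// ler0q divr_ge0.
  have [x1|x1] := ltP x 1; first by apply: cvg_le01; rewrite x0 ltW.
  (* For x >= 1 all m + 1 numerators count; with c = 1 this meets the upper bound exactly. *)
  apply: (cvg_ratio (fun r => ratr r <= x)) => [|m m1].
    by rewrite lexx ler01.
  rewrite (@eq_in_count _ _ predT) => [|n]; last first.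
    rewrite mem_iota ltnS => /= nm; rewrite (le_trans _ x1)//.
    by rewrite fmorph_div/= !ratr_nat ler_pdivrMr ?ltr0n// mul1r ler_nat.
  by rewrite count_predT size_iota mul1r -natr1 lexx andbT lerD2l (le_trans (lerN10 _)).
Qed.
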